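(* Let $\mathbb{F}_q$ be a fixed finite field with $q\ge 3$. It is not true that every family $\{f_n\}_{n\ge 1}$ of polynomials over $\mathbb{F}_q$ in $\mathrm{VP}$, where $f_n$ has $n^{O(1)}$ variables and degree $n$, can be computed by depth three $\Sigma\Pi\Sigma$ circuits over $\mathbb{F}_q$ of size $2^{o(n\log n)}$.
   Context: An arithmetic circuit over a field $\mathbb{F}$ is a directed acyclic graph whose internal nodes are labelled by addition or multiplication gates and whose leaves are labelled by variables or field elements; it computes a polynomial (as a formal polynomial) at its output gate. Its size is its number of nodes. A $\Sigma\Pi\Sigma$ circuit has an addition gate at the top, a middle layer of multiplication gates and a bottom layer of addition gates; it computes a polynomial of the form $\sum_{i=1}^{s}\prod_{j=1}^{d_i}L_{i,j}$, where each $L_{i,j}$ is an affine linear function of the variables over $\mathbb{F}$. A family of polynomials $\{f_n\}$ in $n^{O(1)}$ variables is in $\mathrm{VP}$ if $f_n$ has degree at most $\mathrm{poly}(n)$ and can be computed by an arithmetic circuit of size $\mathrm{poly}(n)$. A family $\{f_n\}$ can be computed by $\Sigma\Pi\Sigma$ circuits of size $2^{o(n\log n)}$ if there is a function $s(n)=2^{o(n\log n)}$ such that each $f_n$ is computed by a $\Sigma\Pi\Sigma$ circuit of size at most $s(n)$. *)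

(* Defs.v *)
From mathcomp Require Import all_boot all_order all_algebra.
From mathcomp Require Import all_classical all_reals all_analysis.
From mathcomp Require Import -(notations) mpoly.
Import numFieldNormedType.Exports.
Set Implicit Arguments.
Unset Strict Implicit.
Unset Printing Implicit Defensive.

Import Order.TTheory GRing.Theory Num.Theory.
Local Open Scope classical_set_scope.
Local Open Scope ring_scope.

Section Circuits.
Variables (F : fieldType) (N : nat).

Inductive leaf : Type :=
  | Var of 'I_N
  | Const of F.

Inductive label : Type :=
  | Leaf of leaf
  | Add
  | Mul.

Definition is_leaf (l : label) : bool := if l is Leaf _ then true else false.

Definition leaf_poly (l : leaf) : mpoly N F :=
  match l with
  | Var i => mpolyX F (mnm1 i)
  | Const c => mpolyC N c
  end.

(* [c_edge u v] means that u is an input of v.  Fan-in is unbounded, and the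
   graph has no parallel edges: a square needs two distinct input nodes. *)
Record circuit : Type := Circuit {
  c_node : finType;
  c_edge : rel c_node;
  c_label : c_node -> label;
  c_out : c_node;
  c_acyclic : forall p : seq c_node, cycle c_edge p -> p = [::];
  c_leafP : forall v : c_node, is_leaf (c_label v) = ~~ [exists u, c_edge u v]
}.

Definition circuit_size (C : circuit) : nat := #|c_node C|.

Definition gate_value (C : circuit) (val : c_node C -> mpoly N F) (v : c_node C) :
    mpoly N F :=
  match c_label v with
  | Leaf l => leaf_poly l
  | Add => \sum_(u | c_edge u v) val u
  | Mul => \prod_(u | c_edge u v) val u
  end.

(* Since the graph is acyclic, exactly one assignment [val] satisfies all the
   gate equations. *)
Definition circuit_computes (C : circuit) (f : mpoly N F) : Prop :=
  exists val : c_node C -> mpoly N F,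
    (forall v, val v = gate_value val v) /\ val (c_out C) = f.

(* The edges from the leaves to the bottom addition gates carry scalars: this is
   what makes a bottom gate compute an arbitrary affine linear function.  The
   coefficient 0 encodes the absence of an edge.  The top gate adds up all the
   multiplication gates. *)
Record sps_circuit : Type := SPSCircuit {
  sps_leaf : finType;
  sps_bottom : finType;
  sps_mul : finType;
  sps_label : sps_leaf -> leaf;
  sps_coef : sps_bottom -> sps_leaf -> F;
  sps_edge : sps_mul -> sps_bottom -> bool
}.

Definition sps_size (C : sps_circuit) : nat :=
  (#|sps_leaf C| + #|sps_bottom C| + #|sps_mul C| + 1)%N.

Definition sps_affine (C : sps_circuit) (b : sps_bottom C) : mpoly N F :=
  \sum_(l : sps_leaf C) sps_coef b l *: leaf_poly (sps_label l).

Definition sps_poly (C : sps_circuit) : mpoly N F :=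
  \sum_(m : sps_mul C) \prod_(b : sps_bottom C | sps_edge m b) sps_affine b.

End Circuits.

(* The additive constant is needed because n ^ c = 1 at n = 1. *)
Definition poly_bounded (P : nat -> nat -> Prop) : Prop :=
  exists c : nat, forall n, (0 < n)%N -> P n (n ^ c + c)%N.

Section Families.
Variables (F : fieldType) (N : nat -> nat).
Variable f : forall n : nat, mpoly (N n) F.

(* [msize p] is 1 + the total degree of p, and 0 for p = 0. *)
Definition in_VP : Prop :=
  [/\ poly_bounded (fun n b => (N n <= b)%N),
      poly_bounded (fun n b => ((msize (f n)).-1 <= b)%N)
    & poly_bounded (fun n b => exists C : circuit F (N n),
        circuit_computes C (f n) /\ (circuit_size C <= b)%N)].

Definition sps_subexp_nlogn (R : realType) : Prop :=
  exists g : nat -> R,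
    g =o_\oo (fun n : nat => n%:R * ln n%:R : R) /\
    forall n, (0 < n)%N -> exists C : sps_circuit F (N n),
      sps_poly C = f n /\ (sps_size C)%:R <= 2 `^ g n.

End Families.

(* Main.v *)
From HB Require Import structures.
Require Import Defs.
From mathcomp Require Import all_boot all_order all_algebra.
From mathcomp Require Import all_classical all_reals all_analysis.
From mathcomp Require Import -(notations) mpoly.
From mathcomp Require Import ring zify.
Set Implicit Arguments.
Unset Strict Implicit.
Unset Printing Implicit Defensive.
Import Order.TTheory GRing.Theory Num.Theory.
Local Open Scope ring_scope.

(* The hard family is f_n = z^(odd n) prod_{k < m} (sum_{i < n} x_{k,i} y_{k,i}), with m = n/2.
   For a choice I of one index per block, put x_{k,i} := [i = I k] t and z := 1: the coefficient
   of t^m in f_n is the monomial y_I = prod_k y_{k, I k}. In a product gate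
   prod_b (a_b t + beta_b(y)), where the beta_b are affine in y, this coefficient depends on y
   only through r linear forms when the beta_b have rank at most r; otherwise it vanishes unless
   at most m of the beta_b vanish at y, which an exponential moment shows to be rare. With s gates
   and s q^r < n^m, some nonzero combination of the n^m monomials y_I is killed by all low-rank
   gates, hence vanishes outside the rare set; but a nonzero set-multilinear polynomial with m
   blocks is nonzero on a fraction at least 2^-m of all points. Hence s is at least about
   (1 - 1/2q)^(-r) 4^(-m), and r of order m log n gives the bound. *)

(** * Coefficients of products of univariate affine factors *)

Definition affine_prod_coef (K : fieldType) (T : finType) (P : pred T)
  (a b : T -> K) (m : nat) : K := (\prod_(t | P t) ((a t)%:P * 'X + (b t)%:P))`_m.

Lemma eq_affine_prod_coef (K : fieldType) (T : finType) (P : pred T)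
    (a b b' : T -> K) (m : nat) :
  {in P, b =1 b'} -> affine_prod_coef P a b m = affine_prod_coef P a b' m.
Proof.
by move=> eq_b; rewrite /affine_prod_coef; under eq_bigr => t Pt do rewrite eq_b //.
Qed.

(** Each factor with zero constant term is a multiple of ['X], so more than m of them push every
    term above degree m. *)
Lemma affine_prod_coef_eq0 (K : fieldType) (T : finType) (P : pred T)
    (a b : T -> K) (m : nat) :
  (m < #|[pred t | P t & b t == 0%R]|)%N -> affine_prod_coef P a b m = 0.
Proof.
move=> lt_m; rewrite /affine_prod_coef (bigID (fun t => b t == 0)) /=.
under eq_bigr => t /andP[_ /eqP->] do rewrite addr0.
rewrite big_split /= prodr_const mulrC mulrA coefMXn.
by rewrite (leq_trans lt_m) //; apply/eq_leq/eq_card.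
Qed.

(** * Distribution of zeros of affine maps of full row rank *)

Lemma row_free_sum_affine (K : finFieldType) (k d : nat) (A : 'M[K]_(k, d))
    (c : 'cV[K]_k) (phi : 'cV[K]_k -> nat) : row_free A ->
  (#|K| ^ k * \sum_(y : 'cV[K]_d) phi (A *m y + c)%R = #|K| ^ d * \sum_w phi w)%N.
Proof.
case/row_freeP=> B AB1.
(* Averaging over the translations [y := y + B w], along which [A y] runs through all of [K^k]. *)
have shift w : (\sum_y phi (A *m y + c)%R = \sum_y phi (w + (A *m y + c))%R)%N.
  rewrite (reindex_inj (addIr (B *m w))) /=; apply: eq_bigr => y _.
  by rewrite mulmxDr mulmxA AB1 mul1mx addrA [w + _]addrC.
have card_cV n : #|{: 'cV[K]_n}| = (#|K| ^ n)%N by rewrite card_mx muln1.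
transitivity (\sum_(w : 'cV[K]_k) \sum_y phi (A *m y + c)%R)%N.
  by rewrite sum_nat_const card_cV.
rewrite (eq_bigr _ (fun w _ => shift w)) exchange_big -card_cV -sum_nat_const /=.
apply: eq_bigr => y _.
by rewrite [RHS](reindex_inj (addIr (A *m y + c))).
Qed.

Lemma sum_cV_prod (K : finFieldType) (k : nat) (h : K -> nat) :
  (\sum_(w : 'cV[K]_k) \prod_i h (w i 0%R) = (\sum_x h x) ^ k)%N.
Proof.
have bijw : bijective (fun w : 'cV[K]_k => [ffun i => w i 0]).
  exists (fun f : {ffun 'I_k -> K} => \col_i f i) => [w | f].
    by apply/colP => i; rewrite mxE ffunE.
  by apply/ffunP => i; rewrite ffunE mxE.
transitivity (\prod_(i < k) \sum_x h x)%N; last by rewrite prod_nat_const card_ord.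
rewrite bigA_distr_bigA (reindex _ (onW_bij _ bijw)) /=.
by apply: eq_bigr => w _; apply: eq_bigr => i _; rewrite ffunE.
Qed.

(* Exponential moment method: give weight 2 to each nonzero coordinate. *)
Lemma card_few_zeros (K : finFieldType) (k d m : nat) (A : 'M[K]_(k, d))
    (c : 'cV[K]_k) : row_free A ->
  (#|[pred y : 'cV[K]_d | #|[pred i | (A *m y + c)%R i 0%R == 0%R]| <= m]|
     * (2 * #|K|) ^ k <= 2 ^ m * (2 * #|K| - 1) ^ k * #|K| ^ d)%N.
Proof.
move=> Afree.
pose h (x : K) := if x == 0 then 1%N else 2%N.
pose phi (w : 'cV[K]_k) := (\prod_i h (w i 0%R))%N.
have sum_h : (\sum_x h x = 2 * #|K| - 1)%N.
  rewrite (bigD1 0) //= /h eqxx (eq_bigr (fun=> 2%N)); last by move=> x /negbTE->.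
  rewrite sum_nat_const.
  have := cardC1 (0 : K); have: (0 < #|K|)%N by apply/card_gt0P; exists 0.
  by move=> K0 ->; case: #|K| K0 => // n _; rewrite mulnC mulnS add1n subn1.
have phiE w : (2 ^ k = phi w * 2 ^ #|[pred i | w i 0%R == 0%R]|)%N.
  rewrite -sum1_card -[in LHS](card_ord k) -sum1_card !expn_sum /phi.
  rewrite [in X in (_ * X)%N]big_mkcond -big_split /=.
  by apply: eq_bigr => i _; rewrite /h inE; case: eqP.
have := row_free_sum_affine c phi Afree.
rewrite sum_cV_prod sum_h => eq_sum.
set bad := #|_|.
(* Markov's inequality: by [phiE], a point with at most m zeros has weight at least 2^(k-m). *)
suff le_bad : (bad * 2 ^ k <= 2 ^ m * \sum_(y : 'cV[K]_d) phi (A *m y + c)%R)%N.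
  rewrite expnMn mulnA mulnC -[leqRHS]mulnA [((_ - 1) ^ k * _)%N]mulnC -eq_sum.
  by rewrite [leqRHS]mulnCA leq_mul2l le_bad orbT.
rewrite /bad -sum1_card big_distrl big_distrr /=.
rewrite [leqRHS](bigID (fun y => #|[pred i | (A *m y + c)%R i 0%R == 0%R]| <= m)%N) /=.
apply: leq_trans (leq_addr _ _); apply: leq_sum => y ym.
by rewrite mul1n (phiE (A *m y + c)) mulnC leq_mul2r leq_pexp2l ?orbT.
Qed.

(** * Linear dependencies and set-multilinear polynomials *)

Lemma exists_left_kernel (K : fieldType) (I J : finType) (M : I -> J -> K) :
  (#|J| < #|I|)%N ->
  exists2 l : I -> K, (exists i, l i != 0) & forall j, \sum_i l i * M i j = 0.
Proof.
move=> ltJI; pose A := \matrix_(i < #|I|, j < #|J|) M (enum_val i) (enum_val j).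
have : kermx A != 0.
  by rewrite kermx_eq0 /row_free neq_ltn (leq_ltn_trans (rank_leq_col A)).
rewrite -nz_row_eq0; set u := nz_row _ => u0.
have uA : u *m A = 0 by apply/sub_kermxP/nz_row_sub.
exists (fun i => u 0 (enum_rank i)).
  by case/rV0Pn: u0 => i ui; exists (enum_val i); rewrite enum_valK.
move=> j; have /rowP/(_ (enum_rank j)) := uA; rewrite [RHS]mxE mxE => uAj.
rewrite -[RHS]uAj [RHS](reindex enum_rank (onW_bij _ (enum_rank_bij I))) /=.
by apply: eq_bigr => i _; rewrite mxE !enum_rankK.
Qed.

(** The cells (k, i) are flattened by [enum_rank] so that points are column vectors on which
    matrices act. *)
Definition block_monomial (K : fieldType) (m n : nat) (I : {ffun 'I_m -> 'I_n})
  (y : 'cV[K]_#|{: 'I_m * 'I_n}|) : K := \prod_k y (enum_rank (k, I k)) 0.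

(* The alternating sum of [P (y + s t)] over [t : {0,1}^m] is the coefficient [l I0] up to sign,
   so every [y] has a translate [y + s t] where [P] does not vanish. *)
Lemma card_set_multilinear_neq0 (K : finFieldType) (m n : nat)
    (l : {ffun 'I_m -> 'I_n} -> K) (I0 : {ffun 'I_m -> 'I_n}) :
  l I0 != 0 ->
  (#|K| ^ #|{: 'I_m * 'I_n}| <=
     #|[pred y | (\sum_I l I * block_monomial I y)%R != 0%R]| * 2 ^ m)%N.
Proof.
move=> lI0.
set d := #|{: 'I_m * 'I_n}|.
pose P (y : 'cV[K]_d) := \sum_I l I * block_monomial I y.
pose s (t : {ffun 'I_m -> bool}) : 'cV[K]_d :=
  \col_j (t (enum_val j).1 && ((enum_val j).2 == I0 (enum_val j).1))%:R.
have alt y :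
    \sum_(t : {ffun 'I_m -> bool}) (\prod_k (-1) ^+ (t k)) * P (y + s t) = (-1) ^+ m * l I0.
  under eq_bigr => t _ do rewrite mulr_sumr.
  have prod_alt I :
      \sum_(t : {ffun 'I_m -> bool}) (\prod_k (-1) ^+ t k) * (l I * block_monomial I (y + s t))
      = l I * \prod_k - (I k == I0 k)%:R.
    (* The alternating sum factors over the blocks: in block k the two values of [t k] cancel the
       entry of [y] and leave -[I k = I0 k], so only I = I0 survives. *)
    pose G k (b : bool) : K :=
      (-1) ^+ b * (y (enum_rank (k, I k)) 0 + (b && (I k == I0 k))%:R).
    transitivity (l I * \sum_(t : {ffun 'I_m -> bool}) \prod_k G k (t k)).
      rewrite mulr_sumr; apply: eq_bigr => t _.
      rewrite mulrCA; congr (_ * _); rewrite /block_monomial -big_split /=.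
      by apply: eq_bigr => k _; rewrite !mxE enum_rankK.
    rewrite -bigA_distr_bigA /=; congr (_ * _); apply: eq_bigr => k _.
    by rewrite big_bool /G /= expr1 expr0 mul1r mulN1r addr0 opprD addrAC addNr add0r.
  rewrite exchange_big /= (eq_bigr _ (fun I _ => prod_alt I)) (bigD1 I0) //=.
  rewrite [X in _ + X]big1 ?addr0 => [|I neI].
    rewrite mulrC; congr (_ * _); rewrite (eq_bigr (fun=> -1)).
      by rewrite prodr_const card_ord.
    by move=> k _; rewrite eqxx.
  have [k neIk] : exists k, I k != I0 k.
    by apply/existsP; apply: contraNT neI => /existsPn eqI; apply/eqP/ffunP => k;
       apply/eqP/negPn/eqI.
  by rewrite (bigD1 k) //= (negbTE neIk) oppr0 mul0r mulr0.
have exP y : exists t, P (y + s t) != 0.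
  apply/existsP; apply: contraT => /existsPn Ps.
  have := alt y; rewrite big1 => [/esym/eqP|t _].
    by rewrite mulf_eq0 signr_eq0 (negbTE lI0).
  by have /negPn/eqP-> := Ps t; rewrite mulr0.
have -> : (#|K| ^ d)%N = #|{: 'cV[K]_d}| by rewrite card_mx muln1.
have <- : #|{: {ffun 'I_m -> bool}}| = (2 ^ m)%N by rewrite card_ffun card_bool card_ord.
rewrite -cardX.
(* Undoing the translation maps the pairs (nonvanishing point, [t]) onto the whole space. *)
pose sh (u : 'cV[K]_d * {ffun 'I_m -> bool}) := u.1 - s u.2.
apply: leq_trans (leq_image_card sh _); apply/subset_leq_card/fintype.subsetP => y _.
have [t Pt] := exP y; apply/fintype.imageP; exists (y + s t, t); last by rewrite /sh addrK.
by rewrite !inE Pt.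
Qed.

(** * Rank dichotomy for one product gate *)

Lemma row_free_rowsub (K : fieldType) (k k' d : nat) (A : 'M[K]_(k, d))
    (f : 'I_k' -> 'I_k) : injective f -> row_free A -> row_free (rowsub f A).
Proof.
move=> inj_f /row_freeP[B AB1]; apply/row_freeP; exists (colsub f B).
by rewrite -mxsub_mul AB1; apply/matrixP => i j; rewrite !mxE (inj_eq inj_f).
Qed.

(** A rank factorization padded to inner dimension exactly r, so that all low-rank gates factor
    through the same space ['cV_r]. *)
Lemma rank_le_mulmx (K : fieldType) (p d r : nat) (A : 'M[K]_(p, d)) :
  (\rank A <= r)%N -> exists (D : 'M[K]_(p, r)) (C : 'M[K]_(r, d)), A = D *m C.
Proof.
move=> le_r; exists (col_ebase A *m pid_mx (\rank A)).
exists (pid_mx (\rank A) *m row_ebase A).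
by rewrite -!mulmxA [pid_mx _ *m (_ *m _)]mulmxA pid_mx_id // mulmxA mulmx_ebase.
Qed.

Section ProductGate.
Variables (K : finFieldType) (B : finType) (E : pred B) (d m r : nat).
Variables (L : B -> 'I_d -> K) (c : B -> K).

Let beta b (y : 'cV[K]_d) := \sum_k L b k * y k 0 + c b.
(** Rows outside the gate are zeroed: the rank is then that of the linear parts of the gate's own
    factors, and independent rows all come from the gate. *)
Let A : 'M[K]_(#|B|, d) :=
  \matrix_(j, k) (if E (enum_val j) then L (enum_val j) k else 0).

Let betaE b y : E b -> beta b y = (A *m y) (enum_rank b) 0 + c b.
Proof.
move=> Eb; rewrite mxE; congr (_ + _); apply: eq_bigr => k _.
by rewrite mxE enum_rankK Eb.
Qed.

(** The two cases are rank at most r and rank above r. The matrix [C] and the set [bad] serve all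
    [i] at once, because only the slopes [al i] vary with [i]. *)
Lemma coef_gate_dichotomy (I : Type) (al : I -> B -> K) :
  (exists C : 'M[K]_(r, d), exists h : I -> 'cV[K]_r -> K, forall i y,
    affine_prod_coef E (al i) (beta^~ y) m = h i (C *m y)) \/
  (exists bad : {set 'cV[K]_d},
    (#|bad| * (2 * #|K|) ^ r <= 2 ^ m * (2 * #|K| - 1) ^ r * #|K| ^ d)%N /\
    forall i y, y \notin bad ->
      affine_prod_coef E (al i) (beta^~ y) m = 0).
Proof.
case: (leqP (\rank A) r) => [/rank_le_mulmx[D [C defA]] | /ltnW le_r].
  left; exists C; exists (fun i v =>
    affine_prod_coef E (al i) (fun b => (D *m v) (enum_rank b) 0 + c b) m).
  by move=> i y; apply: eq_affine_prod_coef => b Eb; rewrite betaE // defA mulmxA.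
right; exists [set y | #|[pred b | E b & beta b y == 0%R]| <= m]%N; split.
  pose f := maxrankfun A \o widen_ord le_r.
  have inj_f : injective f.
    by move=> i j /maxrankfun_inj/(congr1 val) ij; apply: val_inj.
  have free_f : row_free (rowsub f A).
    rewrite (_ : rowsub f A = rowsub (widen_ord le_r) (rowsub (maxrankfun A) A)).
      apply: row_free_rowsub (maxrowsub_free A) => i j /(congr1 val) ij.
      exact: val_inj.
    by apply/matrixP => i k; rewrite !mxE.
  (* A row outside [E] is zero, hence cannot belong to a free family. *)
  have Ef i : E (enum_val (f i)).
    have : row_free (row i (rowsub f A)).
      by rewrite -[row i _]/(rowsub _ _); apply: row_free_rowsub => // u v; rewrite !ord1.
    apply: contraLR => nE; rewrite /row_free.
    suff -> : row i (rowsub f A) = 0 by rewrite mxrank0.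
    by apply/rowP => k; rewrite !mxE (negbTE nE).
  (* The zeros among the r selected forms inject into those of the whole gate, so at most m zeros in
     the gate gives at most m selected ones. *)
  apply: leq_trans (card_few_zeros m (\col_i c (enum_val (f i))) free_f).
  rewrite leq_mul2r; apply/orP; right; apply/subset_leq_card/fintype.subsetP => y.
  rewrite !inE; apply: leq_trans.
  rewrite -(fintype.card_image (f := enum_val \o f)); last exact: inj_comp enum_val_inj inj_f.
  apply/subset_leq_card/fintype.subsetP => _ /fintype.imageP[i zi ->].
  move: zi; rewrite !inE /= Ef betaE // enum_valK mul_rowsub_mx.
  by rewrite [X in X == _]mxE [X in X + _ == _]mxE [X in _ + X == _]mxE.
by move=> i y; rewrite inE -ltnNge => /affine_prod_coef_eq0 ->.
Qed.

End ProductGate.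

(** * Lower bound on the number of product gates *)

Lemma sps_coef_lower_bound (K : finFieldType) (m n r : nat) (G B : finType)
    (E : G -> pred B) (al : {ffun 'I_m -> 'I_n} -> B -> K)
    (L : B -> 'I_#|{: 'I_m * 'I_n}| -> K) (c : B -> K) :
  (forall I (y : 'cV[K]_#|{: 'I_m * 'I_n}|), \sum_g affine_prod_coef (E g) (al I)
     (fun b => \sum_k L b k * y k 0 + c b) m = block_monomial I y) ->
  (#|G| * #|K| ^ r < n ^ m)%N ->
  ((2 * #|K|) ^ r <= #|G| * 4 ^ m * (2 * #|K| - 1) ^ r)%N.
Proof.
set d := #|_| in L *; move=> eq_coef lt_rank.
pose gate g I (y : 'cV_d) := affine_prod_coef (E g) (al I)
  (fun b => \sum_k L b k * y k 0 + c b) m.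
(* [v g] packs a matrix, a function of its output and an exceptional set: this set is empty for
   low-rank gates, and the function is zero for the others. *)
have /choice[v vP] g : exists v : 'M[K]_(r, d) *
    ({ffun 'I_m -> 'I_n} -> 'cV[K]_r -> K) * {set 'cV[K]_d},
  (#|v.2| * (2 * #|K|) ^ r <= 2 ^ m * (2 * #|K| - 1) ^ r * #|K| ^ d)%N /\
  forall I y, y \notin v.2 -> gate g I y = v.1.2 I (v.1.1 *m y).
  have [[C [h hP]]|[bad [le_bad badP]]] := coef_gate_dichotomy (E g) m r L c al.
    exists (C, h, finset.set0); split=> [|I y _]; last exact: hP.
    by rewrite cards0.
  by exists (0, fun _ _ => 0, bad); split => //= I y; apply: badP.
pose bad g := (v g).2.
(* One equation for each gate and each vector of K^r, which is fewer than the n^m unknowns [l I]. *)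
have [|l [I0 lI0] lM] := @exists_left_kernel K {ffun 'I_m -> 'I_n} (G * 'cV[K]_r)%type
    (fun I gu => (v gu.1).1.2 I gu.2).
  by rewrite card_prod card_mx muln1 card_ffun !card_ord.
pose P (y : 'cV[K]_d) := \sum_I l I * block_monomial I y.
have leP : (#|K| ^ d <= #|[pred y | P y != 0%R]| * 2 ^ m)%N.
  exact: card_set_multilinear_neq0 lI0.
have badP y : P y != 0 -> [exists g, y \in bad g].
  apply: contraR => /existsPn nbad; rewrite /P.
  under eq_bigr => I _ do rewrite -eq_coef mulr_sumr.
  rewrite exchange_big big1 //= => g _.
  rewrite -[RHS](lM (g, (v g).1.1 *m y)); apply: eq_bigr => I _; congr (_ * _).
  by case: (vP g) => _ /(_ I y (nbad g)).
have leU : (#|[pred y | P y != 0%R]| <= \sum_g #|bad g|)%N.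
  under eq_bigr => g _ do rewrite -sum1_card big_mkcond.
  rewrite exchange_big -sum1_card big_mkcond; apply: leq_sum => y _ /=.
  case: ifP => // /badP /existsP[g bg].
  by rewrite (bigD1 g) //= bg leq_addr.
have K0 : (0 < #|K| ^ d)%N.
  by rewrite expn_gt0; apply/orP; left; apply/card_gt0P; exists 0.
rewrite -(leq_pmul2l K0).
apply: leq_trans (_ : (\sum_g #|bad g|) * 2 ^ m * (2 * #|K|) ^ r <= _)%N.
  by rewrite leq_mul2r (leq_trans leP) ?orbT // leq_mul2r leU orbT.
rewrite -mulnA mulnCA big_distrl /=.
apply: leq_trans (_ : 2 ^ m * \sum_(g : G) 2 ^ m * (2 * #|K| - 1) ^ r * #|K| ^ d <= _)%N.
  by rewrite leq_mul2l; apply/orP; right; apply: leq_sum => g _; case: (vP g).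
rewrite sum_nat_const -[4%N]/(2 * 2)%N expnMn.
by apply/eq_leq; ring.
Qed.

(** * The hard family, its degree and its small circuits *)

Lemma acyclic_of_height (T : finType) (e : rel T) (h : T -> nat) :
  (forall u v, e u v -> (h u < h v)%N) ->
  forall p : seq T, cycle e p -> p = [::].
Proof.
move=> lt_h [|x p] //= exp.
have : path ltn (h x) (map h (rcons p x)).
  by rewrite path_map; apply: sub_path exp => u v /lt_h.
move/(order_path_min ltn_trans)/allP/(_ (h x)).
by rewrite map_f ?mem_rcons ?mem_head //= ltnn => /(_ isT).
Qed.

Lemma dhomog_prodr (K : nzRingType) (N d : nat) (I : finType) (A : pred I)
    (p : I -> mpoly N K) :
  (forall i, A i -> p i \is ishomog1 d mdeg) ->
  \prod_(i | A i) p i \is ishomog1 (#|A| * d) mdeg.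
Proof.
move=> hp; rewrite -sum1_card big_distrl /=.
apply: (big_ind2 (fun q (k : nat) => q \is ishomog1 k mdeg)).
- exact: dhomog1.
- by move=> q1 k1 q2 k2; apply: dhomogM.
- by move=> i Ai; rewrite mul1n; apply: hp.
Qed.

Lemma msize_dhomog (K : nzRingType) (N d : nat) (p : mpoly N K) :
  p \is ishomog1 d mdeg -> p != 0 -> msize p = d.+1.
Proof.
move=> hp p0; rewrite (dhomog_uniq p0 hp (dhomog_msize hp)) prednK //.
by rewrite lt0n msize_poly_eq0.
Qed.

Section InnerProducts.
Variable F : fieldType.

Section Length.
Variable n : nat.
Local Notation m := n./2.
Local Notation cell := ('I_m * 'I_n)%type.

(* [Some (false, (k, i))] is x_{k,i}, [Some (true, (k, i))] is y_{k,i}, and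
   [None] is the variable that makes the degree odd. *)
Definition ip_index : finType := option (bool * cell).
Definition ip_nvars : nat := #|ip_index|.

(** For even n the parity leaf is the constant 1, which makes the degree exactly n in both cases. *)
Definition ip_leaf (v : ip_index) : leaf F ip_nvars :=
  if ~~ odd n && (v == None) then Const _ 1 else Var _ (enum_rank v).

Definition ip_leaf_poly (v : ip_index) : mpoly ip_nvars F := leaf_poly (ip_leaf v).

Definition ip_row (k : 'I_m) : mpoly ip_nvars F :=
  \sum_(i < n) ip_leaf_poly (Some (false, (k, i))) * ip_leaf_poly (Some (true, (k, i))).

Definition inner_products : mpoly ip_nvars F := ip_leaf_poly None * \prod_k ip_row k.

(** Four layers: leaves, products x_{k,i} y_{k,i}, row sums, output product. *)
Definition ip_node : finType := (ip_index + cell + 'I_m + unit)%type.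

Definition ip_edge (u v : ip_node) : bool :=
  match u, v with
  | inl (inl (inl (Some w))), inl (inl (inr p)) => w.2 == p
  | inl (inl (inr p)), inl (inr k) => p.1 == k
  | inl (inl (inl None)), inr _ | inl (inr _), inr _ => true
  | _, _ => false
  end.

Definition ip_label (v : ip_node) : label F ip_nvars :=
  match v with
  | inl (inl (inl l)) => Leaf (ip_leaf l)
  | inl (inl (inr _)) | inr _ => Mul _ _
  | inl (inr _) => Add _ _
  end.

Definition ip_height (v : ip_node) : nat :=
  match v with
  | inl (inl (inl _)) => 0
  | inl (inl (inr _)) => 1
  | inl (inr _) => 2
  | inr _ => 3
  end.

Lemma ip_acyclic (p : seq ip_node) : cycle ip_edge p -> p = [::].
Proof.
apply: (acyclic_of_height (h := ip_height)).
by move=> [[[[[b q]|]|[k i]]|k]|t] [[[v|q']|k']|t'].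
Qed.

Lemma ip_leafP (n_gt0 : (0 < n)%N) (v : ip_node) :
  is_leaf (ip_label v) = ~~ [exists u, ip_edge u v].
Proof.
apply/esym; case: v => [[[v|p]|k]|t] /=.
- by apply/existsPn => -[[[[[b q]|]|[k i]]|k]|t].
- by apply/negbF/existsP; exists (inl (inl (inl (Some (true, p))))) => /=.
- by apply/negbF/existsP; exists (inl (inl (inr (k, Ordinal n_gt0)))) => /=.
- by apply/negbF/existsP; exists (inl (inl (inl None))).
Qed.

Definition ip_circuit (n_gt0 : (0 < n)%N) : circuit F ip_nvars :=
  Circuit (inr tt) ip_acyclic (ip_leafP n_gt0).

Definition ip_val (v : ip_node) : mpoly ip_nvars F :=
  match v with
  | inl (inl (inl l)) => ip_leaf_poly l
  | inl (inl (inr p)) => ip_leaf_poly (Some (false, p)) * ip_leaf_poly (Some (true, p))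
  | inl (inr k) => ip_row k
  | inr _ => inner_products
  end.

Lemma ip_circuit_computes (n_gt0 : (0 < n)%N) :
  circuit_computes (ip_circuit n_gt0) inner_products.
Proof.
exists ip_val; split=> // -[[[v|p]|k]|t]; rewrite /gate_value //=.
- rewrite !big_sumType /= !big_pred0_eq !mulr1.
  rewrite (bigD1 (Some (false, p))) //=; congr (_ * _).
  rewrite (big_pred1 (Some (true, p))) // => -[[[] q]|] //=.
    by rewrite andbT; apply/eqP/eqP => [->|[->]].
  by rewrite -[RHS]/false; apply/negP => /andP[/eqP->]; rewrite eqxx.
- rewrite !big_sumType /= !big_pred0_eq !addr0.
  rewrite [X in X + _]big_pred0 ?add0r; last by case=> [[? ?]|].
  rewrite (reindex_onto (pair k) snd) => [|[k' i] /eqP/= -> //].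
  by apply: eq_bigl => i; rewrite !eqxx.
- rewrite !big_sumType /= !big_pred0_eq !mulr1.
  by rewrite (big_pred1 None) // => -[[? ?]|].
Qed.

Lemma ip_circuit_size (n_gt0 : (0 < n)%N) :
  (circuit_size (ip_circuit n_gt0) <= n ^ 4 + 4)%N.
Proof.
rewrite /circuit_size !card_sum card_option !card_prod card_bool !card_ord card_unit.
have : (n./2.*2 <= n)%N by rewrite -[leqRHS]odd_double_half leq_addl.
have : (n ^ 2 <= n ^ 4)%N by rewrite leq_pexp2l.
rewrite -muln2 !expnS expn0; nia.
Qed.

Lemma ip_dhomog : inner_products \is ishomog1 n mdeg.
Proof.
rewrite -[X in ishomog1 X _]odd_double_half; apply: dhomogM.
  rewrite /ip_leaf_poly /ip_leaf eqxx andbT.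
  by case: (odd n) => /=; [rewrite dhomogX; apply/eqP/mdeg1 | rewrite mpolyC1 dhomog1].
have -> : (n./2.*2 = #|{: 'I_m}| * 2)%N by rewrite card_ord muln2.
apply: dhomog_prodr => k _; apply: rpred_sum => i _.
by apply: (dhomogM (d := 1) (e := 1));
   rewrite /ip_leaf_poly /ip_leaf andbF /= dhomogX; apply/eqP/mdeg1.
Qed.

(** * Substitution into the hard polynomial and into depth three circuits *)

Section Substitution.
Variables (I : {ffun 'I_m -> 'I_n}) (y : 'cV[F]_#|{: cell}|).

(* x_{k,i} becomes [i = I k] times the indeterminate, and y_{k,i} an entry of [y]. *)
Definition ip_slope (v : ip_index) : F :=
  if v is Some (false, p) then (p.2 == I p.1)%:R else 0.

Definition ip_linear (v : ip_index) (j : 'I_#|{: cell}|) : F :=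
  if v is Some (true, p) then (enum_rank p == j)%:R else 0.

(** The parity variable becomes 1, so both parities of n have the same image. *)
Definition ip_const (v : ip_index) : F := (v == None)%:R.

Definition ip_affine (v : ip_index) : {poly F} :=
  (ip_slope v)%:P * 'X + (\sum_j ip_linear v j * y j 0 + ip_const v)%:P.

Definition ip_subst : mpoly ip_nvars F -> {poly F} :=
  mmap polyC (fun j => ip_affine (enum_val j)).
HB.instance Definition _ := GRing.RMorphism.on ip_subst.

Lemma ip_subst_leaf (v : ip_index) : ip_subst (ip_leaf_poly v) = ip_affine v.
Proof.
rewrite /ip_leaf_poly /ip_leaf /ip_subst; case: ifP => [/andP[_ /eqP->]|_] /=.
  rewrite mmapC /ip_affine /ip_slope /ip_const eqxx mul0r add0r.
  by rewrite big1 ?add0r // => j _; rewrite mul0r.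
by rewrite mmapX mmap1U enum_rankK.
Qed.

Lemma ip_subst_inner_products :
  ip_subst inner_products = block_monomial I y *: 'X^m.
Proof.
rewrite rmorphM rmorph_prod /= ip_subst_leaf {1}/ip_affine /= mul0r add0r.
rewrite big1 ?add0r ?mul1r => [|j _]; last by rewrite mul0r.
rewrite /block_monomial -[X in 'X^X](card_ord m) -prodr_const -scaler_prod.
apply: eq_bigr => k _; rewrite rmorph_sum (bigD1 (I k)) //= [X in _ + X]big1.
  rewrite rmorphM /= !ip_subst_leaf /ip_affine /ip_const /= eqxx mul0r mul1r.
  rewrite big1 ?addr0 ?add0r => [|j _]; last by rewrite mul0r.
  rewrite (bigD1 (enum_rank (k, I k))) //= eqxx mul1r big1 ?addr0.
    by rewrite mulrC mul_polyC.
  by move=> j /negbTE; rewrite eq_sym => ->; rewrite mul0r.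
move=> i /negbTE neiI; rewrite rmorphM /= ip_subst_leaf /ip_affine /ip_const /= neiI.
by rewrite !mul0r big1 ?addr0 ?mul0r // => j _; rewrite mul0r.
Qed.

Section SpsCoefficients.
Variable C : sps_circuit F ip_nvars.

Definition ip_index_of_leaf (l : leaf F ip_nvars) : ip_index :=
  if l is Var j then enum_val j else None.

(* A constant leaf [a] is seen as [a] times the image [1] of the absent parity variable. *)
Definition sps_weight (b : sps_bottom C) (l : sps_leaf C) : F :=
  sps_coef b l * (if sps_label l is Const a then a else 1).

Definition sps_collect (h : ip_index -> F) (b : sps_bottom C) : F :=
  \sum_l sps_weight b l * h (ip_index_of_leaf (sps_label l)).

Lemma ip_subst_sps_affine (b : sps_bottom C) :
  ip_subst (sps_affine b) = (sps_collect ip_slope b)%:P * 'X +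
    (\sum_j sps_collect (ip_linear^~ j) b * y j 0 + sps_collect ip_const b)%:P.
Proof.
rewrite rmorph_sum /=.
transitivity (\sum_l (sps_weight b l)%:P * ip_affine (ip_index_of_leaf (sps_label l))).
  apply: eq_bigr => l _; rewrite /ip_subst mmapZ /sps_weight.
  case: (sps_label l) => [j|a] /=.
    by rewrite mmapX mmap1U mulr1.
  rewrite mmapC /ip_affine /ip_slope /ip_const eqxx mul0r add0r.
  by rewrite big1 ?add0r ?mulr1 -?polyCM // => j _; rewrite mul0r.
rewrite /ip_affine; under [LHS]eq_bigr => l _ do rewrite mulrDr mulrA -!polyCM.
rewrite big_split /= -mulr_suml -!rmorph_sum; congr (_ + _%:P).
under [LHS]eq_bigr => l _ do rewrite mulrDr.
rewrite big_split /=; congr (_ + _).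
under [LHS]eq_bigr => l _ do rewrite mulr_sumr.
rewrite exchange_big /=; apply: eq_bigr => j _; rewrite mulr_suml.
by apply: eq_bigr => l _; rewrite mulrA.
Qed.

Lemma coef_ip_subst_sps_poly (k : nat) :
  (ip_subst (sps_poly C))`_k = \sum_(g : sps_mul C)
    affine_prod_coef (sps_edge g) (sps_collect ip_slope)
      (fun b => \sum_j sps_collect (ip_linear^~ j) b * y j 0 + sps_collect ip_const b) k.
Proof.
rewrite rmorph_sum coef_sum; apply: eq_bigr => g _.
rewrite rmorph_prod /affine_prod_coef.
by under [in LHS]eq_bigr => b _ do rewrite /= ip_subst_sps_affine.
Qed.

End SpsCoefficients.
End Substitution.

(** With all entries of [y] equal to 1, the substitution yields the nonzero polynomial ['X^m]. *)
Lemma inner_products_neq0 : (0 < n)%N -> inner_products != 0.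
Proof.
move=> n_gt0; pose I := [ffun k : 'I_m => Ordinal n_gt0].
apply: contraTneq isT => f0; have := ip_subst_inner_products I (const_mx 1).
rewrite f0 rmorph0 /block_monomial big1 => [|k _]; last by rewrite mxE.
by rewrite scale1r => X0; have := monic_neq0 (monicXn F m); rewrite -X0 eqxx.
Qed.

Lemma msize_inner_products : (0 < n)%N -> msize inner_products = n.+1.
Proof. by move=> n_gt0; apply: msize_dhomog ip_dhomog (inner_products_neq0 n_gt0). Qed.

End Length.
End InnerProducts.

Lemma ip_in_VP (F : fieldType) : in_VP (inner_products F).
Proof.
split.
- exists 4 => n n_gt0; apply: leq_trans (ip_circuit_size F n_gt0).
  rewrite /circuit_size !card_sum -!addnA leq_addr //.
- by exists 1 => n n_gt0; rewrite msize_inner_products //= expn1 addn1.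
- exists 4 => n n_gt0; exists (ip_circuit F n_gt0).
  by split; [apply: ip_circuit_computes | apply: ip_circuit_size].
Qed.

(** * Size bounds and choice of parameters *)

Lemma sps_size_lower_bound (F : finFieldType) (n r : nat) (C : sps_circuit F (ip_nvars n)) :
  sps_poly C = inner_products F n ->
  (sps_size C * #|F| ^ r < n ^ n./2)%N ->
  ((2 * #|F|) ^ r <= sps_size C * 4 ^ n./2 * (2 * #|F| - 1) ^ r)%N.
Proof.
move=> eqC; have leG : (#|sps_mul C| <= sps_size C)%N.
  by rewrite /sps_size addn1 ltnW // ltnS leq_addl.
move=> ltC.
have {ltC} ltG : (#|sps_mul C| * #|F| ^ r < n ^ n./2)%N.
  by apply: leq_ltn_trans ltC; rewrite leq_mul2r leG orbT.
(* Only the slopes depend on [I]; the linear and constant parts are shared, as the gate dichotomy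
   requires. *)
have eq_coef (I : {ffun 'I_n./2 -> 'I_n}) (y : 'cV[F]_#|{: 'I_(n./2) * 'I_n}|) :
    \sum_(g : sps_mul C) affine_prod_coef (sps_edge g) (sps_collect (ip_slope F I))
      (fun b => \sum_j sps_collect (@ip_linear F n ^~ j) b * y j 0
        + sps_collect (@ip_const F n) b) n./2 = block_monomial I y.
  rewrite -coef_ip_subst_sps_poly eqC ip_subst_inner_products.
  by rewrite coefZ coefXn eqxx mulr1.
apply: leq_trans (sps_coef_lower_bound eq_coef ltG) _.
by rewrite !leq_mul2r leG !orbT.
Qed.

(** Bernoulli's inequality (1 + 1/x)^k >= 1 + k/x with denominators cleared. *)
Lemma bernoulli_nat (x k : nat) : (x ^ k * (x + k) <= x.+1 ^ k * x)%N.
Proof.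
elim: k => [|k IHk]; first by rewrite !expn0 addn0.
have := leq_mul IHk (leqnn x.+1).
rewrite !expnS; move: (x ^ k)%N (x.+1 ^ k)%N => u w; nia.
Qed.

(** Bernoulli with x = 2q-1 and k = 2q. This turns the gain (1 - 1/2q)^(-r) into a power of 2. *)
Lemma double_expn_pred (q : nat) :
  (0 < q)%N -> (2 * (2 * q - 1) ^ (2 * q) <= (2 * q) ^ (2 * q))%N.
Proof.
move=> q0; have x0 : (0 < 2 * q - 1)%N by lia.
rewrite -(leq_pmul2r x0).
have := bernoulli_nat (2 * q - 1) (2 * q).
rewrite (_ : (2 * q - 1).+1 = 2 * q)%N; last by lia.
apply: leq_trans; rewrite [X in (_ <= X)%N]mulnC mulnAC -mulnA.
rewrite [X in (_ <= X)%N]mulnC; move: (_ ^ _)%N => u; nia.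
Qed.

Lemma sps_size_inner_products (F : finFieldType) (j : nat)
    (n := (2 ^ (8 * #|F| ^ 2 * j))%N) (C : sps_circuit F (ip_nvars n)) :
  (2 < j)%N -> sps_poly C = inner_products F n ->
  (2 ^ (j * n./2) < sps_size C)%N.
Proof.
move=> j2 eqC; rewrite ltnNge; apply/negP => le_s.
set q := #|F| in n C eqC le_s.
have q0 : (0 < q)%N by apply/card_gt0P; exists 0.
pose m := n./2; have m0 : (0 < m)%N.
  rewrite /m half_gt0 /n -[2%N]/(2 ^ 1)%N -expnM leq_exp2l //; nia.
(* With this r, n^m = 2^(2qr): one factor 2^(qr) absorbs q^r, the other exceeds the assumed size
   2^(jm). *)
pose r := (4 * q * j * m)%N; have r0 : (0 < r)%N by rewrite /r; nia.
have n_def : (n ^ m = 2 ^ (q * r) * 2 ^ (q * r))%N.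
  by rewrite -expnD /n -expnM; congr (2 ^ _)%N; rewrite /r; ring.
have le_q : (q ^ r <= 2 ^ (q * r))%N by rewrite expnM leq_exp2r // ltnW // ltn_expl.
have lt_n : (sps_size C * q ^ r < n ^ m)%N.
  rewrite n_def; apply: leq_ltn_trans (leq_mul le_s (leqnn _)) _.
  apply: leq_ltn_trans (leq_mul (leqnn _) le_q) _.
  rewrite ltn_pmul2r ?expn_gt0 // ltn_exp2l // /r; nia.
have := sps_size_lower_bound eqC lt_n; apply/negP; rewrite -ltnNge.
have r_def : r = (2 * q * (2 * j * m))%N by rewrite /r; ring.
have pow_r : (2 ^ (2 * j * m) * (2 * q - 1) ^ r <= (2 * q) ^ r)%N.
  rewrite r_def [((2 * q - 1) ^ _)%N]expnM [((2 * q) ^ _)%N]expnM -expnMn.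
  by rewrite leq_exp2r ?double_expn_pred //; nia.
apply: leq_trans pow_r; rewrite ltn_pmul2r; last by rewrite expn_gt0; apply/orP; left; lia.
(* What remains is jm + 2m < 2jm, which is where j > 2 enters. *)
apply: leq_ltn_trans (leq_mul le_s (leqnn _)) _.
rewrite -[4%N]/(2 ^ 2)%N -expnM -expnD ltn_exp2l // -/m; nia.
Qed.

Theorem corollary3 (R : realType) (F : finFieldType) (hq : (3 <= #|F|)%N) :
  ~ (forall (N : nat -> nat) (f : forall n : nat, mpoly (N n) F),
       in_VP f ->
       (forall n : nat, (0 < n)%N -> msize (f n) = n.+1) ->
       sps_subexp_nlogn f R).
Proof.
move=> /(_ ip_nvars (inner_products F) (ip_in_VP F) (@msize_inner_products F)).
(* For n = 2^(8 q^2 j), ln n is at most 8 q^2 j; the choice eps = 1/(16 q^2) thus bounds eps n ln n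
   by j n/2, the exponent of the lower bound. *)
case=> g [/eqoP g_o sps_g].
pose q := #|F|; pose eps : R := (16 * q ^ 2)%:R^-1.
have q0 : (0 < q)%N by apply: leq_trans hq.
have eps0 : 0 < eps by rewrite invr_gt0 ltr0n muln_gt0 expn_gt0 q0.
have [N0 _ gN0] := g_o eps eps0.
(* The 3 serves the lower bound, and [N0] puts n in the range of the little-o estimate. *)
pose j := maxn 3 N0; pose n := (2 ^ (8 * q ^ 2 * j))%N.
have [C [eqC le_s]] := sps_g n (expn_gt0 2 _).
have n_ge : (N0 <= n)%N.
  apply: leq_trans (ltnW (ltn_expl _ (isT : 1 < 2)%N)).
  rewrite /j; nia.
(* This is ln 2 <= 1, obtained from ln (1 + x) <= x at x = 1. *)
have ln_n : ln n%:R <= (8 * q ^ 2 * j)%:R :> R.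
  rewrite /n natrX lnXn // -[leRHS]mulr_natl mulr1 -[leRHS]/(1 *+ _).
  have -> : 2 = 1 + 1 :> R by [].
  by rewrite lerMn2r le_ln1Dx ?orbT // (lt_trans _ ltr01) // oppr_lt0.
have n_even : n = (2 * n./2)%N.
  have n_pow : n = (2 ^ (8 * q ^ 2 * j).-1).*2 by rewrite -mul2n -expnS prednK //; nia.
  by rewrite [in RHS]n_pow doubleK mul2n.
have ge0_ln : 0 <= n%:R * ln n%:R :> R.
  by rewrite mulr_ge0 // ln_ge0 // ler1n expn_gt0.
have g_le : g n <= (j * n./2)%:R.
  apply: le_trans (ler_norm _) (le_trans (gN0 n n_ge) _).
  rewrite ger0_norm //.
  apply: le_trans (_ : eps * (n%:R * (8 * q ^ 2 * j)%:R) <= _).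
    by rewrite !ler_pM2l // ltr0n expn_gt0.
  rewrite /eps ler_pdivrMl ?ltr0n; last by nia.
  by rewrite -!natrM ler_nat {1}n_even; nia.
have := sps_size_inner_products (leq_maxl 3 N0 : (2 < j)%N) eqC.
apply/negP; rewrite -leqNgt -(ler_nat R) natrX -powR_mulrn //.
by apply: le_trans le_s _; apply: ler_powR; rewrite ?ler1n.
Qed.
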